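(* For every integer $m\ge 2$ and every integer $\alpha\ge 2$, we have $\alpha\in g^{\mathrm{asc}}_{R,\mathrm{PFA}}(m)$. Equivalently (as witnessed by the explicit automaton $A_{m,\alpha}$ defined in the context), the language $L(A_{m,\alpha})$ satisfies $$\mathrm{asc}(L(A_{m,\alpha}))=m\qquad\text{and}\qquad \mathrm{asc}(L(A_{m,\alpha})^{R})=\alpha .$$
   Context: All automata are deterministic and complete. A DFA is a tuple $A=(Q,\Sigma,\cdot,s,F)$ with finite state set $Q$, finite alphabet $\Sigma$, transition function $\cdot:Q\times\Sigma\to Q$ (extended to words in the usual way, reading left to right), initial state $s\in Q$ and final states $F\subseteq Q$; $L(A)=\{w\in\Sigma^*\mid s\cdot w\in F\}$. A permutation automaton is a DFA in which, for every $a\in\Sigma$, the map $q\mapsto q\cdot a$ is a permutation of $Q$. For a regular language $L$, $\mathrm{asc}(L)$ is the minimum number of final states among all DFAs accepting $L$. For $K\subseteq\Sigma^*$, $K^R=\{w^R\mid w\in K\}$, where $w^R$ is the reversal of the word $w$. For $m\ge 0$, $g^{\mathrm{asc}}_{R,\mathrm{PFA}}(m)$ is the set of all integers $\alpha\ge 0$ for which there exists a language $K$ (over some finite alphabet) accepted by a permutation automaton with $\mathrm{asc}(K)=m$ and $\mathrm{asc}(K^R)=\alpha$. Definition of $A_{m,\alpha}$ for $m,\alpha\ge 2$: put $n=m+\alpha-1$, $[n]=\{1,\dots,n\}$, let $Q=\binom{[n]}{\alpha}$ be the set of $\alpha$-element subsets of $[n]$, $q_I=\{1,\dots,\alpha\}$,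 $T_0=\{1,\dots,\alpha-1\}$. The alphabet is $\Sigma=\{a,b\}$, where $a$ acts on $[n]$ as the $n$-cycle $(1\,2\,\dots\,n)$ and $b$ as the transposition $(1\,2)$; each letter $c\in\Sigma$ acts on $Q$ by $X\cdot c=\{c(i)\mid i\in X\}$. The final states are $F=\{X\in Q\mid T_0\subseteq X\}$. Then $A_{m,\alpha}=(Q,\Sigma,\cdot,q_I,F)$. *)

(* Defs.v *)
From HB Require Import structures.
From mathcomp Require Import all_boot all_fingroup.

Set Implicit Arguments.
Unset Strict Implicit.
Unset Printing Implicit Defensive.

Definition language (S : finType) := seq S -> Prop.

Definition reversal (S : finType) (K : language S) : language S :=
  fun w => exists2 v, K v & w = rev v.

Record dfa (S : finType) := Dfa {
  state : finType;
  step : state -> S -> state;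
  start : state;
  final : {set state}
}.

Definition run (S : finType) (A : dfa S) (q : state A) (w : seq S) : state A :=
  foldl (@step S A) q w.

Definition lang (S : finType) (A : dfa S) : language S :=
  fun w => run (start A) w \in final A.

Definition accepts (S : finType) (A : dfa S) (K : language S) : Prop :=
  forall w, lang A w <-> K w.

Definition permutation_automaton (S : finType) (A : dfa S) : Prop :=
  forall c : S, bijective (fun q : state A => step q c).

(* [asc K k] reads "asc(K) is defined and equals k": it is functional in [k],
   and it has no witness when [K] is not regular. *)
Definition asc (S : finType) (K : language S) (k : nat) : Prop :=
  (exists A : dfa S, accepts A K /\ #|final A| = k) /\
  (forall A : dfa S, accepts A K -> k <= #|final A|).

(* [g_asc_R_PFA m] is a set of natural numbers, given as a predicate. *)
Definition g_asc_R_PFA (m : nat) : nat -> Prop := fun alpha =>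
  exists (S : finType) (K : language S),
    [/\ exists A : dfa S, permutation_automaton A /\ accepts A K,
        asc K m & asc (reversal K) alpha].

Inductive letter := letter_a | letter_b.

Definition bool_of_letter (c : letter) : bool :=
  if c is letter_a then true else false.
Definition letter_of_bool (x : bool) : letter :=
  if x then letter_a else letter_b.
Lemma bool_of_letterK : cancel bool_of_letter letter_of_bool.
Proof. by case. Qed.

HB.instance Definition _ := Finite.copy letter (can_type bool_of_letterK).

(* The ground set {1, ..., n} is represented by 'I_n = {0, ..., n-1}, so that
   every element is shifted down by one. *)
Section Witness.

Variables (m alpha : nat) (hm : 1 < m) (halpha : 1 < alpha).

Local Notation n := (m + alpha - 1).

Lemma ground_gt1 : 1 < n.
Proof. by rewrite -addnBA ?(ltnW halpha) // ltn_addr. Qed.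

Definition pt1 : 'I_n := Ordinal (ltnW ground_gt1).
Definition pt2 : 'I_n := Ordinal ground_gt1.

(* [ordS] is i |-> i + 1 modulo n, i.e. the cycle (1 2 ... n). *)
Definition letter_perm (c : letter) : {perm 'I_n} :=
  match c with
  | letter_a => perm (@ordS_inj n)
  | letter_b => tperm pt1 pt2
  end.

Definition witness_state := {X : {set 'I_n} | #|X| == alpha}.

Lemma letter_image_card (X : witness_state) (c : letter) :
  #|[set letter_perm c i | i in val X]| == alpha.
Proof. by rewrite card_imset ?(eqP (valP X)) //; apply: perm_inj. Qed.

Definition witness_step (X : witness_state) (c : letter) : witness_state :=
  exist _ [set letter_perm c i | i in val X] (letter_image_card X c).

Lemma start_card : #|[set i : 'I_n | i < alpha]| == alpha.
Proof.
have le_an : alpha <= n by rewrite -addnBAC ?leq_addl // ltnW.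
by rewrite -sum1dep_card (big_ord_narrow le_an) sum1_card card_ord.
Qed.

Definition witness_start : witness_state :=
  exist _ [set i : 'I_n | i < alpha] start_card.

Definition T0 : {set 'I_n} := [set i : 'I_n | i < alpha - 1].

Definition witness_automaton : dfa letter :=
  @Dfa letter witness_state witness_step witness_start
    [set X : witness_state | T0 \subset val X].

End Witness.

(* Main.v *)
(** The two letters act on the ground set as an [n]-cycle and an adjacent
    transposition, so words realise every permutation.  Hence all states of the
    witness are reachable, and an [alpha]-set [X] is determined by its residual,
    which records the [(alpha - 1)]-subsets of [X].  Moreover a word [w] whose
    reversal acts as [s] satisfies [T0 \subset s @: start] iff
    [s^-1 @: T0 \subset start]: the reversed language is thus recognised by the
    inverse action on [(alpha - 1)]-sets, started at [T0] and accepting the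
    subsets of the old initial state; distinct such sets are again separated by
    a permutation. *)
Require Import Defs.
From mathcomp Require Import all_boot all_fingroup.
From mathcomp Require Import ssralg zmodp zify.

Set Implicit Arguments.
Unset Strict Implicit.
Unset Printing Implicit Defensive.

(** * Lower bounds on the number of final states *)

Section FinalStateComplexity.

Variable S : finType.

Lemma run_cat (A : dfa S) (q : state A) (u v : seq S) :
  run q (u ++ v) = run (run q u) v.
Proof. by rewrite /run foldl_cat. Qed.

(** Fix an access word for each final state of [A]. If two of these words met in one state of
    another DFA [B] for [K], they would have the same residual, so the two final states would
    coincide; hence [final A] injects into [final B]. *)
Lemma asc_reduced (A : dfa S) (K : language S) :
  accepts A K ->
  (forall q, q \in final A -> exists w, run (start A) w = q) ->
  (forall p q, p \in final A -> q \in final A ->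
     (forall v, (run p v \in final A) = (run q v \in final A)) -> p = q) ->
  asc K #|final A|.
Proof.
move=> accA reach sep; split; first by exists A.
move=> B accB.
(* The implication makes existence hold for every [q], so that [xchoose] yields a total function. *)
have word q : exists w, (q \in final A) ==> (run (start A) w == q).
  have [Fq | _] := boolP (q \in final A); last by exists [::].
  by have [w <-] := reach q Fq; exists w; rewrite eqxx.
pose wd q := xchoose (word q).
have wdP q : q \in final A -> run (start A) (wd q) = q.
  by move=> Fq; have /implyP/(_ Fq)/eqP := xchooseP (word q).
have langE w : (run (start B) w \in final B) = (run (start A) w \in final A).
  by apply/idP/idP; [move/accB/accA | move/accA/accB].
pose h q := run (start B) (wd q).
have h_inj : {in final A &, injective h}.
  move=> p q Fp Fq eq_h; apply: sep => // v.
  rewrite -{1}(wdP p Fp) -{1}(wdP q Fq) -!run_cat -!langE !run_cat.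
  by rewrite -!/(h _) eq_h.
rewrite -(card_in_imset h_inj); apply: subset_leq_card.
by apply/subsetP=> _ /imsetP[q Fq ->]; rewrite langE wdP.
Qed.

End FinalStateComplexity.

(** * Permutations acting on subsets *)

Section Permutations.

Variable T : finType.

Lemma perm_imset_sub (s : {perm T}) (A B : {set T}) :
  (s @: A \subset s @: B) = (A \subset B).
Proof.
apply/idP/idP => [/subsetP sAB | ]; last exact: imsetS.
by apply/subsetP=> x Ax; rewrite -(mem_imset _ _ (@perm_inj _ s)) sAB ?imset_f.
Qed.

Lemma perm_imsetM (s t : {perm T}) (A : {set T}) :
  (s * t)%g @: A = t @: (s @: A).
Proof. by rewrite -imset_comp; apply: eq_imset => x; rewrite /= permM. Qed.

Lemma perm_imset1 (A : {set T}) : (1%g : {perm T}) @: A = A.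
Proof. by rewrite -[RHS]imset_id; apply: eq_imset => x; rewrite perm1. Qed.

(** Swapping a point of [A :\: B] with one of [B :\: A] makes [A :\: B] smaller, which drives the
    induction. *)
Lemma perm_imset_transitive (A B : {set T}) :
  #|A| = #|B| -> exists s : {perm T}, s @: A = B.
Proof.
have [k] := ubnP #|A :\: B|; elim: k A => // k IHk A ltk eqAB.
have [/eqP | [x ABx]] := set_0Vmem (A :\: B).
  rewrite setD_eq0 => sAB; exists 1%g; rewrite perm_imset1.
  by apply/eqP; rewrite eqEcard sAB eqAB leqnn.
have [/eqP | [y BAy]] := set_0Vmem (B :\: A).
  rewrite setD_eq0 => sBA; case/setDP: ABx => Ax; case/negP.
  suff -> : B = A by [].
  by apply/eqP; rewrite eqEcard sBA eqAB leqnn.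
case/setDP: (ABx) => Ax Bx; case/setDP: (BAy) => By Ay.
pose t := tperm x y.
have [||s defB] := IHk (t @: A); last by exists (t * s)%g; rewrite perm_imsetM.
  rewrite -ltnS (leq_trans _ ltk) // ltnS (cardsD1 x (A :\: B)) ABx ltnS.
  apply: subset_leq_card; apply/subsetP=> z /setDP[/imsetP[i Ai ->] Bi].
  move: Bi; rewrite !inE /t; case: tpermP => [_|Ei|/eqP nix _ ->].
  - by rewrite By.
  - by rewrite -Ei Ai in Ay.
  - by rewrite nix Ai.
by rewrite card_imset //; apply: perm_inj.
Qed.

Lemma prod_rev_inv (I : Type) (f : I -> {perm T}) (w : seq I) :
  (\prod_(c <- w) (f c)^-1 = (\prod_(c <- rev w) f c)^-1)%g.
Proof.
elim: w => [|c w IHw]; first by rewrite !big_nil invg1.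
by rewrite rev_cons -cats1 big_cat big_seq1 big_cons IHw invMg.
Qed.

End Permutations.

(** * Generating the symmetric group by words *)

Lemma gen_ordS_tperm (n : nat) (h0 : 0 < n) (h1 : 1 < n) :
  <<[set perm (@ordS_inj n); tperm (Ordinal h0) (Ordinal h1)]>>%g
    = [set: {perm 'I_n}].
Proof.
case: n h0 h1 => [|[|n]] // h0 h1.
rewrite setUC -(@gen_tpermn_circular_shift n (Ordinal h0) (Ordinal h1)).
  congr (<<_ :|: [set _]>>)%g; apply/permP=> i.
  by rewrite !permE; apply: val_inj.
(* The offset between the transposed points must be coprime to the length of the cycle; here it is
   1. *)
by rewrite /= subn0 modnn addn0 modn_small ?coprimen1.
Qed.

(** Finiteness of the group makes products without inverses suffice. *)
Lemma gen_word (gT : finGroupType) (S : finType) (f : S -> gT) (x : gT) :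
  x \in <<f @: [set: S]>>%g -> exists w : seq S, x = (\prod_(c <- w) f c)%g.
Proof.
case/gen_prodgP=> k [c cP ->].
have /fin_all_exists[d dP] i : exists a : S, c i = f a.
  by case/imsetP: (cP i) => a _ ->; exists a.
exists [seq d i | i <- index_enum 'I_k].
by rewrite big_map; apply: eq_bigr => i _; rewrite dP.
Qed.

(** * The witness and its reversal *)

Section WitnessComplexity.

Variables (m alpha : nat) (hm : 1 < m) (halpha : 1 < alpha).

Local Notation n := (m + alpha - 1).
Local Notation wit := (witness_automaton hm halpha).
Local Notation f := (letter_perm hm halpha).
Local Notation qI := (val (witness_start alpha hm)).
Local Notation T0 := (T0 m alpha).

Lemma letter_perm_word (s : {perm 'I_n}) :
  exists w : seq letter, (\prod_(c <- w) f c)%g = s.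
Proof.
suff /gen_word[w ->] : s \in <<f @: [set: letter]>>%g by exists w.
have -> : f @: [set: letter] = [set f letter_a; f letter_b].
  apply/setP=> t; rewrite !inE; apply/imsetP/orP => [[[] _ ->]|[]/eqP->].
  - by left.
  - by right.
  - by exists letter_a.
  - by exists letter_b.
by rewrite gen_ordS_tperm inE.
Qed.

Lemma card_qI : #|qI| = alpha.
Proof. exact: eqP (start_card alpha hm). Qed.

Lemma card_T0 : #|T0| = alpha - 1.
Proof.
have le_an : alpha - 1 <= n by rewrite leq_sub2r ?leq_addl.
by rewrite -sum1dep_card (big_ord_narrow le_an) sum1_card card_ord.
Qed.

Lemma val_run_witness (X : state wit) (w : seq letter) :
  val (run X w) = (\prod_(c <- w) f c)%g @: val X.
Proof.
elim: w X => [|c w IHw] X; first by rewrite big_nil perm_imset1.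
by rewrite big_cons perm_imsetM /= IHw.
Qed.

Lemma witness_permutation : permutation_automaton wit.
Proof.
move=> c; apply: injF_bij => X Y /(congr1 val) /=.
by move/(imset_inj (@perm_inj _ _))/val_inj.
Qed.

Lemma card_final_witness : #|final wit| = m.
Proof.
rewrite -(card_imset _ val_inj).
(* A final state adds to [T0] one of the n - (alpha - 1) = m points outside it. *)
have -> : val @: final wit = [set x |: T0 | x in ~: T0].
  apply/setP=> X; apply/imsetP/imsetP => [[Y] | [x]].
    rewrite inE => sTY ->.
    have /cards1P[x Ex] : #|val Y :\: T0| == 1.
      by rewrite cardsDS // (eqP (valP Y)) card_T0 subKn // ltnW.
    exists x; first by have := set11 x; rewrite -Ex !inE => /andP[].
    by rewrite -Ex setUC setDE setUIr setUCr setIT (setUidPr sTY).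
  rewrite inE => Tx ->.
  have cX : #|x |: T0| == alpha.
    by rewrite cardsU1 Tx card_T0 subnKC // ltnW.
  by exists (exist _ (x |: T0) cX : witness_state m alpha);
    rewrite // inE subsetUr.
rewrite card_in_imset => [|x y].
  by have := cardsC T0; rewrite card_T0 card_ord; lia.
rewrite !inE => Tx Ty eq_xy; have := setU11 x T0.
by rewrite eq_xy !inE (negPf Tx) orbF => /eqP.
Qed.

Lemma asc_witness : asc (lang wit) m.
Proof.
rewrite -[X in asc _ X]card_final_witness.
apply: asc_reduced => // [X _|X Y _ _ eqXY].
  have [s sX] : exists s : {perm 'I_n}, s @: qI = val X.
    by apply: perm_imset_transitive; rewrite card_qI (eqP (valP X)).
  have [w ws] := letter_perm_word s.
  by exists w; apply: val_inj; rewrite val_run_witness ws.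
apply: val_inj; apply/eqP.
rewrite eqEcard (eqP (valP X)) (eqP (valP Y)) leqnn andbT.
apply/subsetP=> x Xx.
have [y] : exists y, y \in val X :\ x.
  apply/card_gt0P; have := cardsD1 x (val X).
  by rewrite Xx (eqP (valP X)); lia.
rewrite !inE => /andP[nyx Xy].
(* A word acting as [s] is accepted from [X], hence from [Y], which forces [val X :\ y], and so [x],
   into [val Y]. *)
have [s sT] : exists s : {perm 'I_n}, s @: (val X :\ y) = T0.
  apply: perm_imset_transitive; rewrite card_T0.
  by have := cardsD1 y (val X); rewrite Xy (eqP (valP X)); lia.
have [w ws] := letter_perm_word s.
have := eqXY w; rewrite !inE !val_run_witness ws -sT !perm_imset_sub.
rewrite subsetDl => /esym/subsetP; apply.
by rewrite !inE eq_sym nyx.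
Qed.

(** All subsets serve as states, so the cardinality is imposed on the final ones; runs from [T0]
    preserve it. *)
Definition reverse_witness : dfa letter :=
  @Dfa letter {set 'I_n} (fun Y c => (f c)^-1%g @: Y) T0
    [set Y : {set 'I_n} | Y \subset qI & #|Y| == alpha - 1].

Lemma run_reverse_witness (Y : {set 'I_n}) (w : seq letter) :
  run (Y : state reverse_witness) w = (\prod_(c <- w) (f c)^-1)%g @: Y.
Proof.
elim: w Y => [|c w IHw] Y; first by rewrite big_nil perm_imset1.
by rewrite big_cons perm_imsetM /= IHw.
Qed.

Lemma reverse_witness_word (s : {perm 'I_n}) :
  exists w : seq letter, (\prod_(c <- w) (f c)^-1)%g = s.
Proof.
have [w ws] := letter_perm_word s^-1.
by exists (rev w); rewrite prod_rev_inv revK ws invgK.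
Qed.

Lemma reverse_witnessP : accepts reverse_witness (reversal (lang wit)).
Proof.
move=> w; rewrite /lang inE run_reverse_witness.
rewrite card_imset ?card_T0 ?eqxx ?andbT; last exact: perm_inj.
rewrite prod_rev_inv; set s := (\prod_(c <- _) _)%g.
rewrite -(perm_imset_sub s) -perm_imsetM mulVg perm_imset1.
have <- : (run (start wit) (rev w) \in final wit) = (T0 \subset s @: qI).
  by rewrite inE val_run_witness.
split=> [Lw | [v Lv ->]]; last by rewrite revK.
by exists (rev w); rewrite ?revK.
Qed.

Lemma asc_reverse_witness : asc (reversal (lang wit)) alpha.
Proof.
have card_final : #|final reverse_witness| = alpha.
  (* Binomial symmetry: choosing alpha - 1 of alpha points amounts to omitting one. *)
  by rewrite cards_draws card_qI -bin_sub ?leq_subr // subKn ?bin1 // ltnW.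
rewrite -[X in asc _ X]card_final; apply: asc_reduced.
- exact: reverse_witnessP.
- move=> Y; rewrite inE => /andP[_ /eqP cY].
  have [s sY] : exists s : {perm 'I_n}, s @: T0 = Y.
    by apply: perm_imset_transitive; rewrite card_T0.
  have [w ws] := reverse_witness_word s.
  by exists w; rewrite run_reverse_witness ws.
- move=> X Y; rewrite !inE => /andP[_ /eqP cX] /andP[_ /eqP cY] eqXY.
  apply/eqP; rewrite eq_sym eqEcard cX cY leqnn andbT.
  apply/subsetP=> x Yx; apply/negPn/negP=> Xx.
  (* Here [x |: X] has alpha points, leaving n - alpha = m - 1 > 0 others. *)
  have [z] : exists z, z \in ~: (x |: X).
    apply/card_gt0P; have := cardsC (x |: X).
    by rewrite cardsU1 Xx cX card_ord; lia.
  rewrite !inE negb_or => /andP[nzx Xz].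
  (* A word for [s] is accepted from [X], hence from [Y], so [Y] lies in [z |: X]; this excludes
     [x]. *)
  have [s sq] : exists s : {perm 'I_n}, s @: (z |: X) = qI.
    by apply: perm_imset_transitive; rewrite card_qI cardsU1 Xz cX; lia.
  have [w ws] := reverse_witness_word s.
  have := eqXY w; rewrite !inE !run_reverse_witness ws -sq !perm_imset_sub.
  rewrite !(card_imset _ (@perm_inj _ _)) cX cY eqxx !andbT subsetUr.
  move=> /esym/subsetP/(_ x Yx).
  by rewrite !inE (negPf Xx) eq_sym (negPf nzx).
Qed.

End WitnessComplexity.

Theorem theorem1 (m alpha : nat) (hm : 1 < m) (halpha : 1 < alpha) :
  g_asc_R_PFA m alpha /\
  [/\ permutation_automaton (witness_automaton hm halpha),
      asc (lang (witness_automaton hm halpha)) m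
    & asc (reversal (lang (witness_automaton hm halpha))) alpha].
Proof.
have perm_wit := witness_permutation hm halpha.
have asc_wit := asc_witness hm halpha.
have asc_rev := asc_reverse_witness hm halpha.
split; last by [].
exists letter, (lang (witness_automaton hm halpha)); split=> //.
by exists (witness_automaton hm halpha).
Qed.
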